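(* Let $n\ge 1$ and let $\mathfrak{g}$ be a nilpotent Lie algebra (over $\mathbb{R}$) of linear operators on $\mathbb{R}^n$. If $\mathfrak{g}$ does not have an eigenvector, then every nonzero $\mathfrak{g}$-invariant linear subspace of $\mathbb{R}^n$ has even dimension.
   Context: A Lie algebra of linear operators on $\mathbb{R}^n$ is a real linear subspace of $\mathrm{End}_{\mathbb{R}}(\mathbb{R}^n)$ closed under the commutator bracket $[A,B]=AB-BA$. An eigenvector for $\mathfrak{g}$ is a nonzero vector $u\in\mathbb{R}^n$ that is an eigenvector (with real eigenvalue) of every operator in $\mathfrak{g}$. A subspace $W$ is $\mathfrak{g}$-invariant if $AW\subset W$ for all $A\in\mathfrak{g}$. *)

(* Defs.v *)
From HB Require Import structures.
From mathcomp Require Import all_boot all_order all_algebra.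
From mathcomp Require Import reals.

Set Implicit Arguments.
Unset Strict Implicit.
Unset Printing Implicit Defensive.

Import GRing.Theory.

Local Open Scope ring_scope.

Section LieAlgebrasOfOperators.

Variables (R : realType) (n : nat).

Implicit Types (A B : 'End('cV[R]_n)) (g U V : {vspace 'End('cV[R]_n)}).

Definition lie_bracket A B : 'End('cV[R]_n) := (A \o B)%VF - (B \o A)%VF.

Definition is_lie_algebra g : Prop :=
  forall A B, A \in g -> B \in g -> lie_bracket A B \in g.

(* [U, V], the linear span of all brackets [A, B] with A in U and B in V.
   By bilinearity it suffices to take the brackets of basis elements;
   [bracketvP] shows that this is the span of all brackets. *)
Definition bracketv U V : {vspace 'End('cV[R]_n)} :=
  <<[seq lie_bracket A B | A <- vbasis U, B <- vbasis V]>>%VS.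

Lemma bracketvP U V (W : {vspace 'End('cV[R]_n)}) :
  reflect (forall A B, A \in U -> B \in V -> lie_bracket A B \in W)
          (bracketv U V <= W)%VS.
Proof.
apply: (iffP span_subvP) => [sW A B Ag Bh | sW C]; last first.
  by case/allpairsP => -[A B] /= [/vbasis_mem ? /vbasis_mem ? ->]; apply: sW.
rewrite (coord_vbasis Ag); elim/big_ind: _ => [|A1 A2 W1 W2|i _].
- by rewrite /lie_bracket comp_lfun0l comp_lfun0r subr0 mem0v.
- by rewrite /lie_bracket comp_lfunDl comp_lfunDr opprD addrACA memvD.
rewrite /lie_bracket -comp_lfunZl -comp_lfunZr -scalerBr memvZ // {Ag}.
rewrite (coord_vbasis Bh); elim/big_ind: _ => [|B1 B2 W1 W2|j _].
- by rewrite comp_lfun0l comp_lfun0r subr0 mem0v.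
- by rewrite comp_lfunDl comp_lfunDr opprD addrACA memvD.
rewrite -comp_lfunZl -comp_lfunZr -scalerBr memvZ //.
by apply: sW; apply: allpairs_f; rewrite mem_nth // size_tuple.
Qed.

Fixpoint lower_central g (k : nat) : {vspace 'End('cV[R]_n)} :=
  if k is k'.+1 then bracketv g (lower_central g k') else g.

(* Nilpotency of g as an abstract Lie algebra; its elements need not be
   nilpotent operators. *)
Definition nilpotent_lie g : Prop := exists k, lower_central g k = 0%VS.

Definition is_eigenvector g (u : 'cV[R]_n) : Prop :=
  u != 0 /\ forall A, A \in g -> exists a : R, A u = a *: u.

Definition is_invariant g (W : {vspace 'cV[R]_n}) : Prop :=
  forall A, A \in g -> (A @: W <= W)%VS.

End LieAlgebrasOfOperators.

(* Main.v *)
(** A minimal odd-dimensional invariant subspace [W] is made of eigenvectors.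
    If [A] commutes with [g] on [W], then, [dim W] being odd, [A] has a real
    eigenvalue [a] on [W]; the kernel and the image of [A - a] on [W] are
    invariant and one of them has odd dimension, so by minimality [A = a] on
    [W].  Now go up the lower central series: if all [[A, B]] with [B] in [g]
    are scalar on [W], these scalars vanish because commutators have trace [0],
    so [A] commutes with [g] on [W] and is itself scalar. *)
Require Import Defs.
From HB Require Import structures.
From mathcomp Require Import all_boot all_order all_algebra.
From mathcomp Require Import reals.
From mathcomp Require polyrcf.

Set Implicit Arguments.
Unset Strict Implicit.
Unset Printing Implicit Defensive.

Import GRing.Theory Num.Theory passmx.

Local Open Scope ring_scope.

Section Endomorphisms.

Lemma sub_lfunE (F : fieldType) (U V : vectType F) (f g : 'Hom(U, V)) u :
  (f - g) u = f u - g u.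
Proof. by rewrite add_lfunE opp_lfunE. Qed.

(** The characteristic polynomial has degree [\dim {:V}], and a polynomial of odd degree over a real
    closed field has a root. *)
Lemma odd_dim_leigenvalue (R : rcfType) (V : vectType R) (f : 'End(V)) :
  odd (\dim {:V}) -> exists a, leigenvalue f a.
Proof.
move=> oddV; have Vb := vbasisP {:V}.
pose M := mxof (vbasis {:V}) (vbasis {:V}) f.
have [|a] := @polyrcf.odd_poly_root R (char_poly M).
  by rewrite size_char_poly /= oddV.
rewrite -eigenvalue_root_char => Ma; exists a.
by rewrite /leigenvalue (leigenspaceE Vb) vsof_eq0.
Qed.

(** Compare traces in a basis: the left side has trace [0] and the right side has trace [c] times
    the dimension, which is nonzero in characteristic [0]. *)
Lemma commutator_scalar (F : fieldType) (V : vectType F) (f g : 'End(V)) c :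
  [pchar F] =i pred0 -> \dim {:V} != 0 ->
  (f \o g)%VF - (g \o f)%VF = c *: \1%VF -> c = 0.
Proof.
move=> charF V_neq0 fgc; have Vb := vbasisP {:V}.
have := congr1 (fun h => \tr (mxof (vbasis {:V}) (vbasis {:V}) h)) fgc.
rewrite !linearB !linearZ /= !(mxof_comp _ _ Vb) mxof1 ?(basis_free Vb) //.
rewrite mxtrace_mulC subrr mxtrace1 => /esym/eqP.
by rewrite mulf_eq0 ((pcharf0P _).1 charF) (negPf V_neq0) orbF => /eqP.
Qed.

Variables (R : rcfType) (V : vectType R).
Implicit Types (f g : 'End(V)) (U W : {vspace V}).

(** The projection [vsproj W] makes this total in [f]; it is the genuine restriction only when [W]
    is stable under [f]. *)
Definition lfun_restrict W f : 'End(subvs_of W) :=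
  (linfun (vsproj W) \o f \o linfun vsval)%VF.

Lemma lfun_restrictE W f w :
  (f @: W <= W)%VS -> vsval (lfun_restrict W f w) = f (vsval w).
Proof.
move=> fW; rewrite !(comp_lfunE, lfunE) /= vsprojK //.
by rewrite (subvP fW) // memv_img // subvsP.
Qed.

Lemma dim_subvs_of W : \dim {:subvs_of W} = \dim W.
Proof. by rewrite dimvf. Qed.

Lemma odd_dim_eigenvector W f : (f @: W <= W)%VS -> odd (\dim W) ->
  exists a u, [/\ u \in W, u != 0 & f u = a *: u].
Proof.
move=> fW oddW.
have [|a fa] := @odd_dim_leigenvalue _ _ (lfun_restrict W f).
  by rewrite dim_subvs_of.
exists a, (vsval (vpick (leigenspace (lfun_restrict W f) a))).
have := memv_pick (leigenspace (lfun_restrict W f) a).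
move: fa; rewrite /leigenvalue -vpick0; move: (vpick _) => w w_neq0.
rewrite memv_ker sub_lfunE scale_lfunE id_lfunE subr_eq0 => /eqP fw.
split; first exact: subvsP.
  by rewrite -(inj_eq subvs_inj) linear0 in w_neq0.
by rewrite -lfun_restrictE // fw linearZ.
Qed.

Lemma commutator_scalar_on W f g c : (f @: W <= W)%VS -> (g @: W <= W)%VS ->
  W != 0%VS -> {in W, forall u, f (g u) - g (f u) = c *: u} -> c = 0.
Proof.
move=> fW gW W_neq0 fgc.
apply: (@commutator_scalar _ _ (lfun_restrict W f) (lfun_restrict W g)).
- exact: pchar_num.
- by rewrite dim_subvs_of dimv_eq0.
apply/lfunP => w; apply: subvs_inj.
rewrite sub_lfunE scale_lfunE id_lfunE 2!comp_lfunE linearB linearZ /=.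
by rewrite !lfun_restrictE // fgc // subvsP.
Qed.

(** Commutation is known only on [W], hence the kernel is cut down to [W] and the image is taken of
    [W] alone. *)
Lemma commute_ker_img W f g : (g @: W <= W)%VS ->
  {in W, forall u, g (f u) = f (g u)} ->
  (g @: (W :&: lker f) <= W :&: lker f)%VS /\ (g @: (f @: W) <= f @: W)%VS.
Proof.
move=> gW fgC; have gWP u : u \in W -> g u \in W.
  by move=> uW; rewrite (subvP gW) // memv_img.
split; apply/subvP => _ /memv_imgP[u uX ->].
  move: uX; rewrite !memv_cap !memv_ker => /andP[uW /eqP fu0].
  by rewrite gWP // -fgC // fu0 linear0 eqxx.
by case/memv_imgP: uX => v vW ->; rewrite fgC // memv_img // gWP.
Qed.

End Endomorphisms.

Section NilpotentLie.

Variables (R : realType) (n : nat) (g : {vspace 'End('cV[R]_n)}).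
Hypothesis g_lie : is_lie_algebra g.

Lemma lower_central_sub k : (lower_central g k <= g)%VS.
Proof.
elim: k => [|k IHk] //=; apply/bracketvP => A B Ag Bk.
by apply: g_lie => //; apply: (subvP IHk).
Qed.

Section MinimalOdd.

Variable W : {vspace 'cV[R]_n}.
Hypotheses (W_inv : is_invariant g W) (oddW : odd (\dim W)).
Hypothesis W_min : forall U : {vspace 'cV[R]_n},
  (U <= W)%VS -> is_invariant g U -> odd (\dim U) -> U = W.

Definition scalar_on (A : 'End('cV[R]_n)) :=
  exists a : R, {in W, forall u, A u = a *: u}.

Lemma commute_scalar_on A : A \in g ->
  (forall B, B \in g -> {in W, forall u, B (A u) = A (B u)}) -> scalar_on A.
Proof.
move=> Ag AC.
have [a [u [uW u_neq0 Au]]] := odd_dim_eigenvector (W_inv Ag) oddW.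
exists a; pose f := A - a *: \1%VF.
have fE v : f v = A v - a *: v by rewrite sub_lfunE scale_lfunE id_lfunE.
have fC B : B \in g -> {in W, forall v, B (f v) = f (B v)}.
  by move=> Bg v vW; rewrite !fE linearB linearZ /= AC.
have fW : (f @: W <= W)%VS.
  apply/subvP => _ /memv_imgP[v vW ->]; rewrite fE memvB ?memvZ //.
  by rewrite (subvP (W_inv Ag)) // memv_img.
have kerW : u \in (W :&: lker f)%VS.
  by rewrite memv_cap uW memv_ker fE Au subrr eqxx.
have dimE := limg_ker_dim f W.
(* By rank-nullity on [W], the dimensions of the kernel and the image add up to the odd number
   [\dim W]. An odd-dimensional image would be all of [W], leaving no room for [u] in the kernel. *)
have [odd_img|even_img] := boolP (odd (\dim (f @: W))).
  have imgW : (f @: W)%VS = W.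
    by apply: W_min => // B Bg; case: (commute_ker_img (W_inv Bg) (fC B Bg)).
  move: dimE; rewrite imgW => /(canRL (addnK _)).
  rewrite subnn => /eqP; rewrite dimv_eq0 => /eqP ker0.
  by move: kerW; rewrite ker0 memv0 (negPf u_neq0).
(* The image has even dimension, so the kernel has odd dimension and minimality applies to it. *)
have kerE : (W :&: lker f)%VS = W.
  apply: W_min; first exact: capvSl.
    by move=> B Bg; case: (commute_ker_img (W_inv Bg) (fC B Bg)).
  by move: oddW; rewrite -dimE oddD (negPf even_img) addbF.
move=> v; rewrite -{1}kerE memv_cap memv_ker fE subr_eq0.
by case/andP => _ /eqP.
Qed.

Lemma bracket_scalar_on A : A \in g ->
  (forall B, B \in g -> scalar_on (lie_bracket B A)) -> scalar_on A.
Proof.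
move=> Ag A_sc; apply: commute_scalar_on => // B Bg u uW.
have [c BAc] := A_sc B Bg.
have BAE v : v \in W -> B (A v) - A (B v) = c *: v.
  by move=> /BAc <-; rewrite sub_lfunE !comp_lfunE.
apply/eqP; rewrite -subr_eq0 BAE //.
rewrite (commutator_scalar_on (W_inv Bg) (W_inv Ag) _ BAE) ?scale0r //.
by rewrite -dimv_eq0; case: (\dim W) oddW.
Qed.

Lemma nilpotent_scalar_on : nilpotent_lie g -> forall A, A \in g -> scalar_on A.
Proof.
case=> k gk0.
have : forall A, A \in lower_central g k -> scalar_on A.
  move=> A; rewrite gk0 memv0 => /eqP ->.
  by exists 0 => u _; rewrite lfunE scale0r.
(* Scalarity, trivial on the zero term of the series, descends from term [k.+1] to term [k], and
   term [0] is [g] itself. *)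
elim: k {gk0} => [|k IHk] //= k_sc; apply: IHk => A Ak.
apply: bracket_scalar_on => [|B Bg]; first exact: (subvP (lower_central_sub k)).
by apply: k_sc; have /bracketvP := subvv (bracketv g (lower_central g k)); apply.
Qed.

End MinimalOdd.

Lemma odd_invariant_eigenvector (W : {vspace 'cV[R]_n}) :
  nilpotent_lie g -> is_invariant g W -> odd (\dim W) ->
  exists u, is_eigenvector g u.
Proof.
move=> g_nil; have [m] := ubnP (\dim W); elim: m W => // m IHm W ltWm W_inv oddW.
(* If there is no eigenvector, the induction hypothesis rules out odd-dimensional invariant
   subspaces smaller than [W], so [W] is minimal. *)
have [//|no_u] := boolp.pselect (exists u, is_eigenvector g u).
have W_min U : (U <= W)%VS -> is_invariant g U -> odd (\dim U) -> U = W.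
  move=> sUW U_inv oddU; apply/eqP; rewrite eqEdim sUW /= leqNgt.
  by apply/negP => ltUW; apply/no_u/(IHm U) => //; apply: leq_trans ltUW ltWm.
(* Any nonzero vector of [W] would do, since each operator of [g] is scalar on the whole of [W]. *)
exists (vpick W); split.
  by rewrite vpick0 -dimv_eq0; case: (\dim W) oddW.
move=> A Ag; have [a Aa] := nilpotent_scalar_on W_inv oddW W_min g_nil Ag.
by exists a; rewrite Aa // memv_pick.
Qed.

End NilpotentLie.

Theorem corollary2 (R : realType) (n : nat) (n_ge1 : (1 <= n)%N)
    (g : {vspace 'End('cV[R]_n)})
    (g_lie : is_lie_algebra g) (g_nil : nilpotent_lie g)
    (g_noeig : ~ (exists u : 'cV[R]_n, is_eigenvector g u))
    (W : {vspace 'cV[R]_n}) (W_neq0 : W != 0%VS) (W_inv : is_invariant g W) :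
  ~~ odd (\dim W).
Proof.
apply/negP => oddW; apply: g_noeig.
exact: (odd_invariant_eigenvector g_lie g_nil W_inv).
Qed.
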